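(* Let $\lambda\in\mathbb{C}$, $\lambda\neq 0$, and let $[\alpha,\beta]$ be a real interval. 1. Let $f:[\alpha,\beta]\to\mathbb{C}$ be a function such that $f\in\mathcal{L}_\lambda^1[\alpha,x]$ for all $x\in[\alpha,\beta]$. Then, for $x\neq 0$, $$\mathbf{D}_\lambda\int_\alpha^x f(t)\,d_\lambda t=f(x)-\frac{\alpha}{\lambda}f\left(\frac{\alpha}{\lambda}\right)\frac{1}{x}.$$ 2. Let $f:[\alpha,\beta]\to\mathbb{C}$ be a function such that $\mathbf{D}_\lambda f\in\mathcal{L}_\lambda^1[\alpha,\beta]$. Then $$\int_\alpha^\beta \mathbf{D}_\lambda f(x)\,d_\lambda x=f(\beta)-f(\alpha).$$
   Context: The $\lambda$-derivative of a function $f$ is $(\mathbf{D}_\lambda f)(x)=\frac{f(\lambda x)}{x}$ for $x\neq 0$, and $(\mathbf{D}_\lambda f)(0)=\lim_{x\to 0}\frac{f(\lambda x)}{x}$, provided that the limit exists. In part 1, $\mathbf{D}_\lambda$ acts on the function $F(y)=\int_\alpha^y f(t)\,d_\lambda t$ of its upper limit, and the result is evaluated at $y=x$. The $\lambda$-integral in $[0,x]$ is defined, for a continuous function $f:[0,x]\to\mathbb{C}$, by $\int_0^x f(t)\,d_\lambda t=\frac{x}{\lambda}f\left(\frac{x}{\lambda}\right)$ provided that $f(x/\lambda)$ exists, and $\int_\alpha^\beta f(x)\,d_\lambda x=\int_0^\beta f(x)\,d_\lambda x-\int_0^\alpha f(x)\,d_\lambda x$, so that $\int_\alpha^\beta f(x)\,d_\lambda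 x=\frac{\beta}{\lambda}f\left(\frac{\beta}{\lambda}\right)-\frac{\alpha}{\lambda}f\left(\frac{\alpha}{\lambda}\right)$. A function is called $\lambda$-integrable in $[\alpha,\beta]$ provided that it is defined at $\alpha/\lambda$ and $\beta/\lambda$. $\mathcal{L}_\lambda^1[\alpha,\beta]$ is the set of functions $f:[\alpha,\beta]\to\mathbb{C}$ such that $|f|$ is $\lambda$-integrable in $[\alpha,\beta]$, i.e. $\int_\alpha^\beta|f|\,d_\lambda x<\infty$. Convention: a function on $[\alpha,\beta]$ may also be defined at points outside $[\alpha,\beta]$; the formulas above evaluate it at such points whenever they call for it.
   Formalization: In part 2, when α<β and α=0 or β=0, f is additionally assumed continuous at 0; without this the claim fails (λ=1, [0,1], f(y)=y for y≠0, f(0)=1), and the assumption then amounts to f(0)=0. *)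

(* Defs.v *)
From mathcomp Require Import all_boot all_order all_algebra.
From mathcomp Require Import all_classical all_reals all_analysis.
From mathcomp Require Import complex.

Set Implicit Arguments.
Unset Strict Implicit.
Unset Printing Implicit Defensive.

Import Order.TTheory GRing.Theory Num.Theory.
Import numFieldNormedType.Exports.

Local Open Scope classical_set_scope.
Local Open Scope ring_scope.

(* [R[i]] packed as a [numFieldType], so that it carries the topology of its
   modulus. *)
Definition Cplx (R : realType) : numFieldType := R[i].

Definition toC (R : realType) (x : R) : Cplx R := real_complex R x.

(* Functions defined on a subset [pdom f] of the complex plane; the values of
   [f] outside [pdom f] are irrelevant.  A function "on" a real interval is one
   whose domain contains that interval. *)
Record pfun (R : realType) := PFun {
  pdom : set (Cplx R);
  pval :> Cplx R -> Cplx R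
}.

Section LambdaCalculus.
Context {R : realType}.
Notation C := (Cplx R).
Implicit Types (lambda x y : C) (a b : R) (f : pfun R).

Definition seg a b : set C := [set toC t | t in `[a, b]].

Definition pabs f : pfun R := PFun (pdom f) (fun x => `|f x|).

(* The filter of punctured neighbourhoods of 0, restricted to the points x at
   which f(lambda x)/x makes sense. *)
Definition lderiv_filter lambda f : set_system C :=
  within [set x | pdom f (lambda * x)] (0 : C)^'.

(* 0 is required to be a limit point because convergence along the improper
   filter would hold vacuously. *)
Definition lderiv lambda f : pfun R := PFun
  [set x | if x == 0 then
             limit_point [set z | pdom f (lambda * z)] (0 : C) /\
             cvg ((fun z => f (lambda * z) / z) @ lderiv_filter lambda f)
           else pdom f (lambda * x)]
  (fun x => if x == 0 then
              lim ((fun z => f (lambda * z) / z) @ lderiv_filter lambda f)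
            else f (lambda * x) / x).

Definition lint0 lambda f x : C := x / lambda * f (x / lambda).

(* The limits of integration may be complex: for non-real lambda,
   the lambda-derivative of an integral evaluates it at such a point. *)
Definition lint lambda f x y : C := lint0 lambda f y - lint0 lambda f x.

Definition lintegrable lambda f x y : Prop :=
  pdom f (x / lambda) /\ pdom f (y / lambda).

(* The requirement that the integral of |f| be finite is its existence:
   its value is a complex number. *)
Definition L1 lambda a b f : Prop :=
  seg a b `<=` pdom f /\ lintegrable lambda (pabs f) (toC a) (toC b).

(* The function y |-> \int_x^y f(t) d_lambda t, defined where the integral is. *)
Definition lprimitive lambda f x : pfun R :=
  PFun [set y | lintegrable lambda f x y] (fun y => lint lambda f x y).

(* Continuity relative to the domain. *)
Definition pcontinuous_at f x : Prop :=
  f @ within (pdom f) (nbhs x) --> f x.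

End LambdaCalculus.

(* Main.v *)
Require Import Defs.
From mathcomp Require Import all_boot all_order all_algebra.
From mathcomp Require Import all_classical all_reals all_analysis.
From mathcomp Require Import complex.
Import Order.TTheory GRing.Theory Num.Theory.
Import numFieldNormedType.Exports.
Local Open Scope classical_set_scope.
Local Open Scope ring_scope.

(** The derivative samples [f] at [lambda * x] and the integral at [x / lambda], so the two scalings
    cancel and both parts are computations away from 0. At an endpoint 0 the integral of the
    derivative contributes 0, so part 2 needs [f 0 = 0] there; [lderiv_dom0_eq0] obtains this from
    the existence of the derivative at 0 and continuity. *)

Lemma toC_eq0 (R : realType) (x : R) : (toC x == 0) = (x == 0).
Proof. exact: fmorph_eq0. Qed.

Lemma lint0_lderiv (R : realType) (lambda : Cplx R) (f : pfun R) (y : Cplx R) :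
  lambda != 0 -> y != 0 -> lint0 lambda (lderiv lambda f) y = f y.
Proof.
move=> l0 y0; have z0 : y / lambda != 0 by rewrite mulf_neq0 ?invr_eq0.
by rewrite /lint0 /= (negPf z0) [lambda * _]mulrC divfK // mulrC divfK.
Qed.

Lemma lint0_0 (R : realType) (lambda : Cplx R) (f : pfun R) :
  lint0 lambda f 0 = 0.
Proof. by rewrite /lint0 mul0r mul0r. Qed.

(** The limit point supplies a nonzero admissible point in every neighbourhood of 0. Properness is
    what makes limits along this filter unique. *)
Lemma lderiv_filter_proper (R : realType) (lambda : Cplx R) (f : pfun R) :
  limit_point [set z | pdom f (lambda * z)] (0 : Cplx R) ->
  ProperFilter (lderiv_filter lambda f).
Proof.
move=> lim0; rewrite /lderiv_filter; apply: Build_ProperFilter_ex => A.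
rewrite /within /= /dnbhs /within /= => /lim0[z [z0 fz Az]].
by exists z; exact: Az.
Qed.

(* Along the filter defining the derivative at 0, f (lambda z) tends to f 0 by
   continuity and to 0 because it is z times a convergent quotient. *)
Lemma lderiv_dom0_eq0 (R : realType) (lambda : Cplx R) (f : pfun R) :
  pcontinuous_at f 0 -> pdom (lderiv lambda f) 0 -> f 0 = 0.
Proof.
move=> f0; rewrite /= eqxx => -[/lderiv_filter_proper PF Df].
have z0 : z @[z --> lderiv_filter lambda f] --> (0 : Cplx R).
  by apply: cvg_trans (cvg_within _) _; exact: cvg_within.
have flim0 : f (lambda * z) @[z --> lderiv_filter lambda f] --> (0 : Cplx R).
  set l := lim (f (lambda * z) / z @[z --> lderiv_filter lambda f]) in Df.
  rewrite -[X in _ --> X](mul0r l); apply: cvg_trans (cvgM z0 Df); apply: near_eq_cvg.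
  rewrite /lderiv_filter; apply: cvg_within; near=> z.
  have zn0 : z != 0 by near: z; exact: nbhs_dnbhs_neq.
  by rewrite /= mulrC divfK.
have flimf0 : f (lambda * z) @[z --> lderiv_filter lambda f] --> f 0.
  have lz0 : lambda * z @[z --> lderiv_filter lambda f] --> (0 : Cplx R).
    by rewrite -[X in _ --> X](mulr0 lambda); apply: cvgM z0; exact: cvg_cst.
  (* Continuity is relative to [pdom f], and the filter keeps [lambda * z] inside it. *)
  apply: cvg_comp f0 => A /lz0 lA; rewrite /= /nbhs /=; near=> z.
  have fz : pdom f (lambda * z) by near: z; exact: withinT.
  by move: fz; near: z; exact: lA.
exact: cvg_unique flimf0 flim0.
Unshelve. all: by end_near. Qed.

Theorem theorem1 (R : realType) (lambda : Cplx R) (hlambda : lambda != 0)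
    (alpha beta : R) (hab : alpha <= beta) :
  (forall f : pfun R,
     seg alpha beta `<=` pdom f ->
     (forall x : R, alpha <= x <= beta -> L1 lambda alpha x f) ->
     forall x : R, alpha <= x <= beta -> x != 0 ->
       pdom (lderiv lambda (lprimitive lambda f (toC alpha))) (toC x) /\
       lderiv lambda (lprimitive lambda f (toC alpha)) (toC x) =
         f (toC x)
         - toC alpha / lambda * f (toC alpha / lambda) * (1 / toC x)) /\
  (forall f : pfun R,
     seg alpha beta `<=` pdom f ->
     L1 lambda alpha beta (lderiv lambda f) ->
     (alpha < beta -> alpha = 0 \/ beta = 0 -> pcontinuous_at f 0) ->
     lint lambda (lderiv lambda f) (toC alpha) (toC beta) =
       f (toC beta) - f (toC alpha)).
Proof.
split=> f fab.
  move=> fL1 x xab x0; have [_ [fa _]] := fL1 x xab.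
  (* The primitive is evaluated at [lambda * x], where its integral samples [f] at [x] itself. *)
  have lxl : lambda * toC x / lambda = toC x by rewrite mulrC mulKf.
  have x0' : toC x != 0 by rewrite toC_eq0.
  rewrite /= (negPf x0'); split.
    split; first exact: fa.
    by rewrite lxl; apply: fab; exists x => //=; rewrite in_itv.
  by rewrite /lint /lint0 lxl mulrBl [toC x * _]mulrC mulfK // mul1r.
move=> [_ [Da Db]] f0.
(* If the endpoints coincide, both sides vanish; continuity at 0 is assumed only for
   [alpha < beta]. *)
move: hab; rewrite le_eqVlt => /predU1P[<-|ab]; first by rewrite /lint !subrr.
have lintE (t : R) : t = alpha \/ t = beta ->
    lint0 lambda (lderiv lambda f) (toC t) = f (toC t).
  move=> tab; have [t0|t0] := eqVneq t 0; last first.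
    by rewrite lint0_lderiv // toC_eq0.
  have tC0 : toC t = 0 by apply/eqP; rewrite toC_eq0 t0.
  rewrite tC0 lint0_0; symmetry; apply: (@lderiv_dom0_eq0 _ lambda).
    by apply: f0 => //; case: tab => <-; [left|right].
  (* Integrability puts [toC t / lambda] in the domain of the derivative, and for [t = 0] this point
     is 0. *)
  rewrite -(mul0r lambda^-1) -tC0; case: tab => ->; [exact: Da|exact: Db].
by rewrite /lint !lintE; [|left|right].
Qed.
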